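(* Let $n\ge 3$ be odd and let $G=\langle A,\beta\mid \beta^2=\alpha,\ \beta a\beta^{-1}=f(a)\ \text{for all } a\in A\rangle$ be a finite non-abelian group of order $2n$, where $A$ is an abelian subgroup of index $2$, $\alpha\in A$, and $f$ is an automorphism of $A$ of order $2$ with $f(\alpha)=\alpha$. Let $X\subseteq A\setminus\{e\}$ and $Y\subseteq A$. Then the Cayley graph $\Gamma=\mathrm{Cay}(G,X\cup Y\beta)$ is a DSRG with parameters $(2n,n-1,\frac{n-1}{2},\frac{n-3}{2},\frac{n-1}{2})$ if and only if: (i) $|X|=|Y|=\frac{n-1}{2}$; (ii) $X\cap f(X)=\emptyset$ and $X\cup f(X)=A\setminus\{e\}$; (iii) $\alpha=e$; (iv) $\overline{X}f(\overline{X})=\overline{Y}f(\overline{Y})$.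
   Context: $e$ denotes the identity. For a finite group $H$ and $S\subseteq H\setminus\{e\}$, $\mathrm{Cay}(H,S)$ is the directed graph with vertex set $H$ and an arc from $x$ to $y$ iff $yx^{-1}\in S$. $Y\beta=\{y\beta:y\in Y\}$, $f(X)=\{f(x):x\in X\}$. A DSRG with parameters $(N,k,\mu,\lambda,t)$ is a $k$-regular loopless directed graph on $N$ vertices such that every vertex $x$ has exactly $t$ vertices $z$ with $x\to z$ and $z\to x$, and for vertices $x\ne y$ the number of $z$ with $x\to z\to y$ is $\lambda$ if $x\to y$ and $\mu$ otherwise. For $X\subseteq A$, $\overline{X}=\sum_{x\in X}x$ in the group algebra $\mathbb{C}A$, and $f$ is extended linearly to $\mathbb{C}A$; products are taken in $\mathbb{C}A$. *)

(* Defs.v *)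
From mathcomp Require Import all_boot all_algebra all_fingroup all_character.
From mathcomp Require Import complex reals.
Set Implicit Arguments.
Unset Strict Implicit.
Unset Printing Implicit Defensive.

Import GRing.Theory.
Local Open Scope ring_scope.

(* "k-regular" for a directed graph: in-degree and out-degree both equal k. *)
Record is_dsrg (T : finType) (e : rel T) (N k mu lambda t : nat) : Prop := IsDsrg {
  dsrg_order : #|T| = N;
  dsrg_loopless : irreflexive e;
  dsrg_outdeg : forall x, #|[set z | e x z]| = k;
  dsrg_indeg : forall x, #|[set z | e z x]| = k;
  dsrg_recip : forall x, #|[set z | e x z && e z x]| = t;
  dsrg_paths : forall x y, x != y ->
    #|[set z | e x z && e z y]| = if e x y then lambda else mu
}.

Definition cayley (gT : finGroupType) (S : {set gT}) : rel gT :=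
  fun x y => (y * x^-1)%g \in S.

(* The group algebra F[A] is the library's group_ring, i.e. the span of the
   faithful regular representation inside 'M[F]_#|A|, in which gset_mx F A X is
   the sum of the elements of X.  The coefficient of a \in A in an element M of
   the group algebra is gring_row M 0 (gring_index A a). *)
Definition galg_map (F : fieldType) (gT : finGroupType) (A : {group gT})
    (f : gT -> gT) (M : 'M[F]_#|A|) : 'M[F]_#|A| :=
  \sum_(a in A) gring_row M 0 (gring_index A a) *: regular_repr F A (f a).

(* Main.v *)
Require Import Defs.
From HB Require Import structures.
From mathcomp Require Import all_boot all_order all_algebra all_fingroup all_character.
From mathcomp Require Import complex reals.
From mathcomp Require Import cyclic ring zify.

(**
  Put n = 2m + 1, W = X + f(X) + 1 and let J be the sum of all elements of A.
  The graph is a DSRG iff |X| + |Y| = 2m and, in the integral group ring Z[A],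
      X^2 + Y f(Y) alpha + X = m J   and   Y W = m J.
  Augmentation gives |X| = |Y| = m.  Let k be the sum of the kernel K of
  a |-> a f(a).  Then k f(X) = k X, so D = n Y k - m |K| J satisfies D = -2 X D;
  hence D is divisible by every power of 2 and vanishes, so n divides m |K| and
  K = A.  Thus f is inversion and alpha = 1.  Now put E = W - J.  The equations
  give X f(X) - Y f(Y) = X E, and X E is a symmetric idempotent whose
  coefficient at 1 is |X| - |Y| = 0.  As that coefficient is also the sum of
  the squares of all coefficients, X E = 0.  Then E is a symmetric idempotent
  with coefficient 0 at 1 as well, so E = 0.
*)

Set Implicit Arguments.
Unset Strict Implicit.
Unset Printing Implicit Defensive.

Import GRing.Theory Num.Theory.
Local Open Scope ring_scope.

(** * The integral group ring of a finite abelian group *)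

Section IntegralGroupRing.

Variable aT : finGroupType.

(** The phantom commutativity proof is recorded in the type, so that a commutative ring structure
    can be attached to it and [ring] applies. *)
Definition zgring (_ : @commutative aT aT mulg) : Type := {ffun aT -> int}.

Variable aC : @commutative aT aT mulg.
Local Notation ZA := (zgring aC).

HB.instance Definition _ := GRing.Zmodule.on ZA.

Definition zg_one : ZA := [ffun g => (g == 1%g)%:R].
Definition zg_mul (u v : ZA) : ZA :=
  [ffun g => \sum_h u h * v (h^-1 * g)%g].

Lemma zg_mulC : commutative zg_mul.
Proof.
move=> u v; apply/ffunP=> g; rewrite !ffunE.
rewrite (reindex (fun h => h^-1 * g)%g) /=; last first.
  by exists (fun h => g * h^-1)%g => h _; rewrite invMg invgK ?mulKVg ?mulgKV.
apply: eq_bigr => h _; rewrite mulrC; congr (v _ * _).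
by rewrite invMg invgK aC mulKVg.
Qed.

Lemma zg_mulA : associative zg_mul.
Proof.
move=> u v w; apply/ffunP=> g; rewrite !ffunE.
under [RHS]eq_bigr => h _ do rewrite ffunE mulr_suml.
rewrite exchange_big /=; apply: eq_bigr => k _.
rewrite ffunE mulr_sumr [RHS](reindex_inj (mulgI k)) /=.
by apply: eq_bigr => h _; rewrite mulKg invMg mulgA mulrA.
Qed.

Lemma zg_mul1 : left_id zg_one zg_mul.
Proof.
move=> u; apply/ffunP=> g; rewrite ffunE (bigD1 1%g) //= big1 => [|h neh].
  by rewrite ffunE eqxx invg1 mul1g mul1r addr0.
by rewrite ffunE (negPf neh) mul0r.
Qed.

Lemma zg_mulDl : left_distributive zg_mul +%R.
Proof.
move=> u v w; apply/ffunP=> g; rewrite !ffunE -big_split.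
by apply: eq_bigr => h _; rewrite ffunE mulrDl.
Qed.

Lemma zg_one_neq0 : zg_one != 0.
Proof. by apply/eqP => /ffunP/(_ 1%g); rewrite !ffunE eqxx. Qed.

HB.instance Definition _ := GRing.Zmodule_isComNzRing.Build ZA
  zg_mulA zg_mulC zg_mul1 zg_mulDl zg_one_neq0.

Lemma zgM (u v : ZA) g : (u * v) g = \sum_h u h * v (h^-1 * g)%g.
Proof. by rewrite ffunE. Qed.

Lemma zgMV (u v : ZA) g : (u * v) g = \sum_h u h * v (g * h^-1)%g.
Proof. by rewrite zgM; apply: eq_bigr => h _; rewrite aC. Qed.

Lemma zgD (u v : ZA) g : (u + v) g = u g + v g. Proof. by rewrite ffunE. Qed.
Lemma zgN (u : ZA) g : (- u) g = - u g. Proof. by rewrite ffunE. Qed.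
Lemma zg1 g : (1 : ZA) g = (g == 1%g)%:R. Proof. by rewrite ffunE. Qed.

Lemma zgMz (c : int) (u : ZA) g : (c%:~R * u) g = c * u g.
Proof.
have zgMn k : (u *+ k) g = u g *+ k by elim: k => [|k IH]; rewrite ?ffunE // !mulrS zgD IH.
rewrite mulrzl; case: c => k; first by rewrite zgMn -mulr_natl natz.
by rewrite NegzE mulrNz zgN zgMn mulNr -mulr_natl natz.
Qed.

Definition zgset (B : {set aT}) : ZA := [ffun g => (g \in B)%:R].
Definition zgaug (u : ZA) : int := \sum_g u g.

Lemma zgsetE B g : zgset B g = (g \in B)%:R. Proof. by rewrite ffunE. Qed.

Lemma zgaug_set B : zgaug (zgset B) = #|B|%:R.
Proof.
rewrite -sum1_card natr_sum big_mkcond /=.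
by apply: eq_bigr => g _; rewrite ffunE; case: (g \in B).
Qed.

Lemma zgM_setT (u : ZA) : u * zgset setT = (zgaug u)%:~R * zgset setT.
Proof.
apply/ffunP=> g; rewrite zgMz zgM ffunE inE mulr1.
by apply: eq_bigr => h _; rewrite ffunE inE mulr1.
Qed.

Lemma zgM_set1 (u : ZA) a g : (u * zgset [set a]) g = u (g * a^-1)%g.
Proof.
rewrite mulrC zgM (bigD1 a) //= big1 => [|h neh].
  by rewrite ffunE inE eqxx mul1r addr0 aC.
by rewrite ffunE inE (negPf neh) mul0r.
Qed.

Lemma zgset1 : zgset [set 1%g] = 1.
Proof. by apply/ffunP=> g; rewrite zgsetE zg1 inE. Qed.

Lemma zg_eq_2mul_eq0 (u v : ZA) : u = 2%:~R * (v * u) -> u = 0.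
Proof.
move=> uE.
have pow j : u = (2 ^+ j)%:~R * (v ^+ j * u).
  elim: j => [|j IH]; first by rewrite !expr0 !mul1r.
  by rewrite {1}uE {1}IH !exprS intrM; ring.
apply/ffunP=> g; rewrite [RHS]ffunE.
(* The exponent [|u g|] suffices: 2 ^ [|u g|] divides [u g] but exceeds its absolute value. *)
have := congr1 (fun w : ZA => `|w g|%N) (pow `|u g|%N).
rewrite zgMz abszM abszX; set w := (_ * u) g => /= ug.
have lt2 := ltn_expl `|u g|%N (isT : (1 < 2)%N).
apply/eqP; rewrite -absz_eq0.
have [w0|w0] := posnP `|w|%N; first by rewrite ug w0 muln0.
suff : (`|u g| < `|u g|)%N by rewrite ltnn.
by apply: (leq_trans lt2); rewrite {2}ug leq_pmulr.
Qed.

(** By symmetry the coefficient of [u * u] at 1 is the sum of the squares of the coefficients of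
    [u]; by idempotence it is [u 1]. *)
Lemma zg_symm_idem_eq0 (u : ZA) :
  u * u = u -> (forall g, u g^-1%g = u g) -> u 1%g = 0 -> u = 0.
Proof.
move=> uu uV u1; have := congr1 (fun w : ZA => w 1%g) uu; rewrite zgM u1.
move=> sum0; apply/ffunP=> g; rewrite [RHS]ffunE; apply/eqP; rewrite -sqrf_eq0.
have sq : \sum_h u h ^+ 2 = 0.
  by rewrite -[RHS]sum0; apply: eq_bigr => h _; rewrite mulg1 uV.
by move/eqP: sq; rewrite psumr_eq0 => [/allP/(_ g (mem_index_enum g)) //|h _]; apply: sqr_ge0.
Qed.

End IntegralGroupRing.

(** * An involutive automorphism acting on the group ring *)

Section GroupRingInvolution.

Variables (aT : finGroupType) (aC : @commutative aT aT mulg).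
Local Notation ZA := (zgring aC).
Local Notation J := (zgset aC setT).

Variable f : aT -> aT.
Hypotheses (fM : {morph f : a b / (a * b)%g}) (fK : involutive f).

(** As [f] is its own inverse, precomposition with [f] is the linear extension of [f]. *)
Definition zgmap (u : ZA) : ZA := [ffun g => u (f g)].

Lemma zgmapE u g : zgmap u g = u (f g). Proof. by rewrite ffunE. Qed.

Lemma zgmapK : involutive zgmap.
Proof. by move=> u; apply/ffunP=> g; rewrite !zgmapE fK. Qed.

Lemma invol_morph1 : f 1%g = 1%g.
Proof. by apply: (mulgI (f 1%g)); rewrite -fM !mulg1. Qed.

Lemma invol_morphV g : f g^-1%g = (f g)^-1%g.
Proof. by apply: (mulgI (f g)); rewrite -fM !mulgV invol_morph1. Qed.

Lemma zgmapD u v : zgmap (u + v) = zgmap u + zgmap v.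
Proof. by apply/ffunP=> g; rewrite !(zgmapE, zgD). Qed.

Lemma zgmapM u v : zgmap (u * v) = zgmap u * zgmap v.
Proof.
apply/ffunP=> g; rewrite zgmapE !zgM (reindex_inj (inv_inj fK)).
by apply: eq_bigr => h _; rewrite !zgmapE fM invol_morphV.
Qed.

Lemma zgmap_set B : zgmap (zgset aC B) = zgset aC (f @: B).
Proof.
apply/ffunP=> g; rewrite zgmapE !zgsetE; congr (_%:R); congr nat_of_bool.
by rewrite -{2}(fK g) mem_imset //; apply: inv_inj.
Qed.

Lemma zgmap_setT : zgmap J = J.
Proof. by apply/ffunP=> g; rewrite zgmapE !zgsetE !inE. Qed.

Lemma zgmap_set1 a : f a = a -> zgmap (zgset aC [set a]) = zgset aC [set a].
Proof. by rewrite zgmap_set imset_set1 => ->. Qed.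

Lemma zgmap_intr c u : zgmap (c%:~R * u) = c%:~R * zgmap u.
Proof. by apply/ffunP=> g; rewrite zgmapE !zgMz zgmapE. Qed.

Lemma zgmap1 : zgmap 1 = 1.
Proof. by rewrite -zgset1 zgmap_set1 ?invol_morph1. Qed.

Lemma zgaug_map u : zgaug (zgmap u) = zgaug u.
Proof.
rewrite /zgaug [RHS](reindex_inj (inv_inj fK)).
by apply: eq_bigr => g _; rewrite zgmapE.
Qed.

(** In this form the ring laws yield additivity and multiplicativity of the augmentation. *)
Lemma zgaugE (u : ZA) : zgaug u = (u * J) 1%g.
Proof. by rewrite zgM_setT zgMz zgsetE inE mulr1. Qed.

Lemma zgaugM (u v : ZA) : zgaug (u * v) = zgaug u * zgaug v.
Proof. by rewrite zgaugE -mulrA zgM_setT mulrCA zgMz -zgaugE mulrC. Qed.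

Lemma zgaugD (u v : ZA) : zgaug (u + v) = zgaug u + zgaug v.
Proof. by rewrite zgaugE mulrDl zgD -!zgaugE. Qed.

Lemma zgaug1 : zgaug (1 : ZA) = 1.
Proof. by rewrite -zgset1 zgaug_set cards1. Qed.

Lemma zgaug_intr c (u : ZA) : zgaug (c%:~R * u) = c * zgaug u.
Proof. by rewrite zgaugE -mulrA zgMz -zgaugE. Qed.

Definition antifixed := [set a | a * f a == 1]%g.

(* [a] and [f a] lie in the same coset of the kernel of [a |-> a * f a]. *)
Lemma zg_antifixed_map u : zgset aC antifixed * zgmap u = zgset aC antifixed * u.
Proof.
apply/ffunP=> g; rewrite ![zgset _ _ * _]mulrC !zgMV (reindex_inj (inv_inj fK)).
apply: eq_bigr => h _; rewrite zgmapE fK !zgsetE !inE !fM !invol_morphV fK.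
congr (_ * (_ == _)%:R); rewrite -!mulgA; congr (_ * _)%g.
by rewrite [LHS]aC [RHS]aC -!mulgA; congr (_ * _)%g; apply: aC.
Qed.

(** * The two group ring equations against conditions (i) to (iv) *)

Section Equations.

Variables (m : nat) (alpha : aT) (X Y : {set aT}).
Hypotheses (card_aT : #|aT| = m.*2.+1) (f_alpha : f alpha = alpha).
Hypothesis (X1 : 1%g \notin X).
Local Notation x := (zgset aC X).
Local Notation y := (zgset aC Y).
Local Notation fx := (zgmap x).
Local Notation fy := (zgmap y).
Local Notation al := (zgset aC [set alpha]).

Lemma zg_equations_suff :
  [/\ #|X| = m /\ #|Y| = m, x + fx + 1 = J, alpha = 1%g & x * fx = y * fy] ->
  [/\ (#|X| + #|Y|)%N = m.*2, x * x + y * fy * al + x = m%:~R * J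
    & y * (x + fx + 1) = m%:~R * J].
Proof.
case=> -[cX cY] xE -> xy; rewrite zgset1; split; first by rewrite cX cY addnn.
  (* Once y f(y) is replaced by x f(x), both left sides are multiples of x + f(x) + 1 = J. *)
  rewrite -xy; transitivity (x * (x + fx + 1)); first by ring.
  by rewrite xE zgM_setT zgaug_set cX -natz.
by rewrite xE zgM_setT zgaug_set cY -natz.
Qed.

Hypothesis card_XY : (#|X| + #|Y|)%N = m.*2.
Hypothesis eqA : x * x + y * fy * al + x = m%:~R * J.
Hypothesis eqB : y * (x + fx + 1) = m%:~R * J.

(** With a = |X| and b = |Y|, augmenting [eqB] gives b(2a + 1) = m(2m + 1). Substituting b = 2m - a
    turns this into (a - m)(2a - 2m + 1) = 0, whose second factor is odd. *)
Lemma zg_equations_cardX : #|X| = m.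
Proof.
clear f_alpha X1 eqA.
have := congr1 (@zgaug _ aC) eqB.
rewrite zgaugM !zgaugD zgaug_intr zgaug_map zgaug1 !zgaug_set cardsT card_aT.
set a := #|X|; set b := #|Y|; have : (a + b)%N = m.*2 by [].
rewrite !pmulrn; nia.
Qed.

Lemma zg_equations_cardY : #|Y| = m.
Proof. by move: card_XY; rewrite zg_equations_cardX -addnn => /addnI. Qed.

Lemma antifixedT : antifixed = setT.
Proof.
set k := zgset aC antifixed.
pose c : int := m%:Z * #|antifixed|%:Z.
pose D : ZA := m.*2.+1%:~R * (y * k) - c%:~R * J.
have kJ : k * J = #|antifixed|%:~R * J by rewrite zgM_setT zgaug_set -natz.
have xJ : x * J = m%:~R * J by rewrite zgM_setT zgaug_set zg_equations_cardX -natz.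
(* This is [eqB] multiplied by [k], which absorbs the difference between [fx] and [x]. *)
have eqBk : y * k + 2%:~R * (x * (y * k)) = c%:~R * J.
  transitivity (k * (y * (x + fx + 1))).
    transitivity (y * (k * x + k * fx + k)); last by ring.
    by rewrite zg_antifixed_map -/k; ring.
  by rewrite eqB mulrCA kJ /c intrM; ring.
have D0 : D = 0.
  (* The factor 2m + 1 in [D] balances the multiples of J: replacing y k by its value from [eqBk]
     leaves (2m + 1)c - c = 2mc of them, and -2 x D contains 2c x J = 2mc J. *)
  apply: (@zg_eq_2mul_eq0 _ _ D (- x)).
  have yk : y * k = c%:~R * J - 2%:~R * (x * (y * k)) by rewrite -eqBk; ring.
  have -> : 2%:~R * (- x * D) = - (m.*2.+1)%:~R * (2%:~R * (x * (y * k))) + 2%:~R * c%:~R * (x * J).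
    by rewrite /D; ring.
  rewrite /D {1}yk xJ -addnn intS PoszD intrD; ring.
(* The coefficient of [D] at 1 shows that 2m + 1 divides m |K|; being coprime to m, it divides
   |K|. *)
have := congr1 (fun w : ZA => w 1%g) D0.
rewrite /D zgD zgN !zgMz zgsetE inE mulr1 [in RHS]ffunE => /eqP.
rewrite subr_eq0 /c => /eqP kE.
have : (m.*2.+1 %| m * #|antifixed|)%N.
  have := dvdz_mulr ((y * k) 1%g) (dvdzz m.*2.+1).
  by rewrite kE dvdzE abszM.
rewrite Gauss_dvdr; last first.
  by rewrite coprime_sym /coprime -addn1 -mul2n gcdnMDl gcdn1.
move=> dv; apply/eqP; rewrite eqEcard subsetT cardsT card_aT dvdn_leq //.
by apply/card_gt0P; exists 1%g; rewrite inE invol_morph1 mulg1.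
Qed.

Lemma invol_inv g : f g = g^-1%g.
Proof.
have := in_setT g; rewrite -antifixedT inE => /eqP gf.
by apply: (mulgI g); rewrite gf mulgV.
Qed.

(** Inversion fixes [alpha], so its order divides both 2 and the odd order of the group. *)
Lemma zg_equations_alpha1 : alpha = 1%g.
Proof.
have al2 : (alpha ^+ 2 = 1)%g by rewrite expgS expg1 -{2}f_alpha invol_inv mulgV.
apply/eqP; rewrite -order_eq1 -dvdn1.
have co : coprime 2 #|aT| by rewrite coprime2n card_aT /= odd_double.
by rewrite -(eqP co) dvdn_gcd order_dvdn al2 eqxx -cardsT order_dvdG ?inE.
Qed.

Lemma zg_equations_nec : x + fx + 1 = J /\ x * fx = y * fy.
Proof.
have eqA1 : x * x + y * fy + x = m%:~R * J by rewrite -eqA zg_equations_alpha1 zgset1 mulr1.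
have xJ : x * J = m%:~R * J by rewrite zgM_setT zgaug_set zg_equations_cardX -natz.
have yJ : y * J = m%:~R * J by rewrite zgM_setT zgaug_set zg_equations_cardY -natz.
have fxJ : fx * J = m%:~R * J by rewrite -{1}zgmap_setT -zgmapM xJ zgmap_intr zgmap_setT.
have eqAf : fx * fx + y * fy + fx = m%:~R * J.
  have := congr1 zgmap eqA1.
  by rewrite zgmap_intr zgmap_setT !zgmapD !zgmapM zgmapK => <-; ring.
pose E : ZA := x + fx + 1 - J.
have yE : y * E = 0 by rewrite /E mulrBr eqB yJ subrr.
(* The difference of [eqAf] and [eqA1] is (f(x) - x)(f(x) + x + 1) = 0, and f(x) J = x J. *)
have xfxE : fx * E = x * E.
  apply/eqP; rewrite -subr_eq0; apply/eqP.
  transitivity ((fx * fx + y * fy + fx) - (x * x + y * fy + x) - (fx * J - x * J)).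
    by rewrite /E; ring.
  by rewrite eqAf eqA1 fxJ xJ; ring.
(* Multiply [eqA1] by [E]: the term in y dies by [yE], and J E = 0 because [E] has augmentation m +
   m + 1 - (2m + 1). *)
have x2E : x * x * E = - (x * E).
  apply/eqP; rewrite -subr_eq0; apply/eqP.
  transitivity ((x * x + y * fy + x) * E - fy * (y * E)); first by ring.
  rewrite yE eqA1 /E; transitivity (m%:~R * (x * J + fx * J + J - J * J)); first by ring.
  rewrite xJ fxJ zgM_setT zgaug_set cardsT card_aT -addnn pmulrn intS PoszD !intrD; ring.
have JE : J * E = 0.
  transitivity (x * J + fx * J + J - J * J); first by rewrite /E; ring.
  rewrite xJ fxJ zgM_setT zgaug_set cardsT card_aT -addnn pmulrn intS PoszD !intrD; ring.
have EE : E * E = 2%:~R * (x * E) + E.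
  transitivity (x * E + fx * E + E - J * E); first by rewrite {1}/E; ring.
  by rewrite xfxE JE; ring.
have EN : E = x + fx + 1 + (-1)%:~R * J by rewrite /E; ring.
have Em : zgmap E = E.
  by rewrite EN !zgmapD zgmap_intr zgmapK zgmap1 zgmap_setT; ring.
have Ef g : E g^-1%g = E g by rewrite -invol_inv -zgmapE Em.
(* Expand x E and eliminate x J by means of [eqA1]. *)
have xEE : x * E = x * fx - y * fy.
  transitivity (x * fx + (x * x + y * fy + x) - y * fy - x * J); first by rewrite /E; ring.
  by rewrite eqA1 xJ; ring.
have xE0 : x * E = 0.
  apply: zg_symm_idem_eq0.
  (* Idempotence: x^2 E^2 = 2x(x^2 E) + x^2 E = -2 x^2 E - x E = 2 x E - x E. *)
  - transitivity (x * x * (E * E)); first by ring.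
    rewrite EE; transitivity (2%:~R * (x * (x * x * E)) + x * x * E); first by ring.
    by rewrite x2E; transitivity (- 2%:~R * (x * x * E) - x * E); [ring|rewrite x2E; ring].
  - by move=> g; rewrite -invol_inv -zgmapE zgmapM Em xfxE.
  (* Since [f] is inversion, the coefficient of b f(b) at 1 is the sum of the squares of the
     coefficients of b. *)
  have z1 B : (zgset aC B * zgmap (zgset aC B)) 1%g = #|B|%:R.
    rewrite zgM -zgaug_set; apply: eq_bigr => h _.
    by rewrite mulg1 zgmapE invol_inv invgK !zgsetE; case: (h \in B).
  by rewrite xEE zgD zgN !z1 zg_equations_cardX zg_equations_cardY subrr.
split; last by apply/eqP; rewrite -subr_eq0 -xEE xE0.
apply/eqP; rewrite -subr_eq0 -/E; apply/eqP.
(* With x E = 0, [EE] reads E^2 = E; the coefficient at 1 is 0 + 0 + 1 - 1, as 1 is not in [X]. *)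
apply: zg_symm_idem_eq0 => //; first by rewrite EE xE0 mulr0 add0r.
by rewrite /E !zgD zgN zgmapE invol_morph1 zg1 !zgsetE inE (negPf X1) eqxx.
Qed.

End Equations.

End GroupRingInvolution.

(** * Directed strongly regular Cayley graphs via factorizations in the group *)

Lemma cayley_dsrgP (gT : finGroupType) (S : {set gT}) (k mu lambda t : nat) :
  1%g \notin S ->
  is_dsrg (cayley S) #|gT| k mu lambda t <->
  #|S| = k /\
  forall g, #|[set s in S | g * s^-1 \in S]%g| =
    if g == 1%g then t else if g \in S then lambda else mu.
Proof.
move=> S1.
(* Translating the middle vertex z to s = z x^-1 turns the walks from x to y into the factorizations
   of y x^-1 in S, so only y x^-1 matters. *)
have walk x y : #|[set z | cayley S x z && cayley S z y]| =
                #|[set s in S | (y * x^-1) * s^-1 \in S]%g|.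
  rewrite -(card_imset _ (mulIg x^-1)%g); apply: eq_card => s.
  rewrite inE; apply/imsetP/andP => [[z]|[sS yS]].
    by rewrite inE => /andP[xz zy] ->; rewrite invMg invgK mulgA mulgKV.
  exists (s * x)%g; last by rewrite mulgK.
  by rewrite inE /cayley mulgK sS invMg mulgA.
have out x : #|[set z | cayley S x z]| = #|S|.
  rewrite -(card_imset S (mulIg x)); apply: eq_card => z; rewrite inE /cayley.
  apply/idP/imsetP => [zS|[s sS ->]]; last by rewrite mulgK.
  by exists (z * x^-1)%g; rewrite ?mulgKV.
have inn x : #|[set z | cayley S z x]| = #|S|.
  have injx : injective (fun s => s^-1 * x)%g by move=> s s' /mulIg/invg_inj.
  rewrite -(card_imset S injx); apply: eq_card => z; rewrite inE /cayley.
  apply/idP/imsetP => [zS|[s sS ->]]; last by rewrite invMg invgK mulKVg.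
  by exists (x * z^-1)%g; rewrite ?invMg ?invgK ?mulgKV.
split=> [[_ _ outk _ recip paths]|[cS cP]].
  split=> [|g]; first by rewrite -(out 1%g) outk.
  have := walk 1%g g; rewrite invg1 mulg1 => walk1; rewrite -walk1.
  have [->|g1] := eqVneq g 1%g; first exact: recip.
  by rewrite paths 1?eq_sym // /cayley invg1 mulg1.
split=> // [x|x|x|x|x y xy].
- by rewrite /cayley mulgV (negPf S1).
- by rewrite out.
- by rewrite inn.
- by rewrite walk mulgV cP eqxx.
by rewrite walk cP -eq_mulgV1 eq_sym (negPf xy).
Qed.

(** * Splitting a group along a subgroup of index two *)

Section IndexTwo.

Variables (gT : finGroupType) (A : {group gT}) (beta : gT).
Hypotheses (index_A : #|[set: gT] : A|%g = 2%N) (betaA : beta \notin A).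

(** The coset of [beta] lies in the complement of [A] and has the same cardinality, so the two
    coincide. *)
Lemma index2_mem g : g \notin A -> (g * beta^-1)%g \in A.
Proof.
move=> gA; rewrite -mem_rcoset.
have sub : (A :* beta)%g \subset ~: (A : {set gT}).
  apply/subsetP=> h; rewrite mem_rcoset inE => hb; apply: contra betaA => hA.
  by move: hb; rewrite groupMl ?groupV.
have : (A :* beta)%g == ~: (A : {set gT}).
  rewrite eqEcard sub card_rcoset.
  have := cardsC (A : {set gT}); rewrite -cardsT -(Lagrange (subsetT A)) index_A.
  by rewrite muln2 -addnn => /addnI cA; rewrite cA leqnn.
by move/eqP->; rewrite inE.
Qed.

Lemma sum_index2 (F : gT -> int) :
  \sum_s F s = \sum_(u : subg_of A) F (sgval u)
               + \sum_(u : subg_of A) F (sgval u * beta)%g.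
Proof.
rewrite (bigID (mem A)) /=; congr (_ + _).
  rewrite (reindex_onto sgval (subg A)) => [|g gA]; last exact: subgK.
  by apply: eq_bigl => u; rewrite sgvalK eqxx subgP.
rewrite (reindex_onto (fun u : subg_of A => sgval u * beta)%g
                      (fun g => subg A (g * beta^-1)%g)).
  by apply: eq_bigl => u; rewrite mulgK sgvalK eqxx groupMl ?subgP ?betaA.
by move=> g gA /=; rewrite -[sgval _]/(val _) subgK ?mulgKV ?index2_mem.
Qed.

End IndexTwo.

(** * Coefficients in the span of the regular representation *)

Section RegularCoefficients.

Variables (F : fieldType) (gT : finGroupType) (A : {group gT}).
Local Notation r u := (regular_repr F A (sgval u)).

(** The linear map [gring_proj] at [u] reads off the coefficient of [u]. *)
Lemma regular_coef_inj (c d : subg_of A -> F) :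
  \sum_u c u *: r u = \sum_u d u *: r u -> c =1 d.
Proof.
have coef (b : subg_of A -> F) u :
    @gring_proj F gT A (sgval u) (\sum_v b v *: r v) = (b u)%:M.
  rewrite linear_sum (bigD1 u) //= big1 => [|v vu].
    by rewrite linearZ /= gring_projE ?subgP // eqxx scalemx1 addr0.
  rewrite linearZ /= gring_projE ?subgP // (inj_eq val_inj) eq_sym (negPf vu).
  by rewrite scaler0.
move=> eq_cd u; have := congr1 (@gring_proj F gT A (sgval u)) eq_cd.
by rewrite !coef => /matrixP/(_ 0 0); rewrite !mxE !mulr1n.
Qed.

Lemma gset_mx_subg (B : {set gT}) : B \subset A ->
  gset_mx F A B = \sum_(u : subg_of A) (sgval u \in B)%:R *: r u.
Proof.
move=> BA; rewrite (reindex_onto (subg A) sgval) => [|u _]; last exact: sgvalK.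
rewrite /gset_mx [RHS](bigID (mem B)) /= [X in _ + X]big1 ?addr0; last first.
  move=> a /andP[/eqP aE aB]; move: aE aB; rewrite -[sgval _]/(val _) => ->.
  by move/negPf->; rewrite scale0r.
have BAi a : a \in B -> val (subg A a) = a by move=> /(subsetP BA)/subgK.
apply: eq_big => [a|a aB]; last by rewrite BAi // aB scale1r.
by rewrite andbC; case aB: (a \in B) => //=; rewrite BAi ?eqxx.
Qed.

Lemma galg_map_gset_mx (f : gT -> gT) (B : {set gT}) : B \subset A ->
  galg_map f (gset_mx F A B)
  = \sum_(u : subg_of A) (sgval u \in B)%:R *: regular_repr F A (f (sgval u)).
Proof.
move=> BA; rewrite /galg_map (reindex_onto sgval (subg A)) => [|a aA]; last exact: subgK.
apply: eq_big => [u|u _]; first by rewrite sgvalK eqxx subgP.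
congr (_ *: _).
transitivity (@gring_proj F gT A (sgval u) (gset_mx F A B) 0 0); first by rewrite /gring_proj /= [RHS]mxE [RHS]mxE.
rewrite /gset_mx linear_sum summxE.
have projE b : b \in B -> @gring_proj F gT A (sgval u) (regular_repr F A b) 0 0 = (sgval u == b)%:R.
  by move=> bB; rewrite gring_projE ?subgP ?(subsetP BA) //; case: eqP; rewrite mxE.
rewrite (eq_bigr _ projE).
case uB: (sgval u \in B).
  rewrite (bigD1 (sgval u)) //= eqxx big1 ?addr0 // => b /andP[_].
  by rewrite eq_sym => /negPf->.
by rewrite big1 // => b bB; case: eqP uB bB => // ->->.
Qed.

End RegularCoefficients.

Lemma abelian_subgC (gT : finGroupType) (A : {group gT}) :
  abelian A -> @commutative (subg_of A) (subg_of A) mulg.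
Proof. by move/centsP=> abA u v; apply: val_inj; apply: abA; apply: subgP. Qed.

(** * Walk counts in G as coefficients in the group ring of A *)

Section CayleyIndexTwo.

Variables (gT : finGroupType) (A : {group gT}) (alpha beta : gT).
Variables (f : {perm gT}) (X Y : {set gT}).
Hypotheses (abelian_A : abelian A) (index_A : #|[set: gT] : A|%g = 2%N).
Hypotheses (betaA : beta \notin A) (alpha_A : alpha \in A).
Hypothesis (beta_sq : (beta ^+ 2)%g = alpha).
Hypothesis (beta_conj : forall a, a \in A -> (beta * a * beta^-1)%g = f a).
Hypotheses (f_aut : f \in Aut A) (f_order : #[f]%g = 2%N).
Hypotheses (X_sub : X \subset A :\ 1%g) (Y_sub : Y \subset A).

Local Notation aT := (subg_of A).
Local Notation aC := (abelian_subgC abelian_A).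

(** The integral group ring lives over a whole group type, so [f], [X] and [Y] are carried over to
    [subg_of A]. *)
Definition subg_fun (u : aT) : aT := subg A (f (sgval u)).
Local Notation fA := subg_fun.
Definition subg_preim (B : {set gT}) : {set aT} := [set u | sgval u \in B].
Local Notation X' := (subg_preim X).
Local Notation Y' := (subg_preim Y).
Local Notation x := (zgset aC X').
Local Notation y := (zgset aC Y').
Local Notation S := (X :|: (Y :* beta)%g).

Lemma invol_perm : involutive f.
Proof.
have := expg_order f; rewrite f_order expgS expg1 => ff a.
by rewrite -permM ff perm1.
Qed.

Lemma mul_beta a : a \in A -> (beta * a = f a * beta)%g.
Proof. by move=> aA; rewrite -beta_conj // mulgKV. Qed.

Lemma sgval_fun u : sgval (fA u) = f (sgval u).
Proof. by rewrite -[sgval _]/(val _) subgK // Aut_closed ?subgP. Qed.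

Lemma subg_funM : {morph fA : u v / (u * v)%g}.
Proof.
move=> u v; apply: val_inj; rewrite /= !sgval_fun.
by rewrite -!(autmE f_aut) morphM ?subgP.
Qed.

Lemma subg_funK : involutive fA.
Proof. by move=> u; apply: val_inj; rewrite /= !sgval_fun invol_perm. Qed.

Lemma card_subg_preim (B : {set gT}) : B \subset A -> #|subg_preim B| = #|B|.
Proof.
move=> BA; rewrite -(card_imset _ (@subg_inj _ A)); apply: eq_card => b.
apply/imsetP/idP => [[u]|bB]; first by rewrite inE => uB ->.
by exists (subg A b); rewrite ?inE -[sgval _]/(val _) subgK ?(subsetP BA).
Qed.

Lemma X_subA : X \subset A.
Proof. exact: subset_trans X_sub (subD1set _ _). Qed.

Lemma notA_mulr_beta (u : aT) : (sgval u * beta)%g \notin A.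
Proof. by rewrite groupMl ?subgP. Qed.

Lemma mem_conn_A (u : aT) : (sgval u \in S) = (u \in X').
Proof.
rewrite !inE mem_rcoset; case: (sgval u \in X) => //=.
apply/negP => /(subsetP Y_sub); rewrite groupMl ?subgP // groupV.
exact/negP.
Qed.

Lemma mem_conn_Ab (u : aT) : ((sgval u * beta)%g \in S) = (u \in Y').
Proof.
rewrite !inE mem_rcoset mulgK; case: (_ \in Y); rewrite ?orbT // orbF.
by apply/negP => /(subsetP X_subA); apply/negP/notA_mulr_beta.
Qed.

Lemma conn1 : 1%g \notin S.
Proof.
have := mem_conn_A 1%g; rewrite /= => ->; rewrite inE /=.
by apply/negP => /(subsetP X_sub); rewrite !inE eqxx.
Qed.

Lemma card_conn : #|S| = (#|X| + #|Y|)%N.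
Proof.
rewrite cardsU card_rcoset (_ : _ :&: _ = set0) ?cards0 ?subn0 //.
apply/setP=> g; rewrite !inE mem_rcoset; apply/negP=> /andP[gX gY].
have := subsetP Y_sub _ gY.
by rewrite (groupMl _ (subsetP X_subA _ gX)) groupV; apply/negP.
Qed.

Definition conn_walks g : nat := #|[set s in S | g * s^-1 \in S]%g|.

Lemma conn_walksE g :
  (conn_walks g)%:R = \sum_s (s \in S)%:R * (g * s^-1 \in S)%g%:R :> int.
Proof.
rewrite /conn_walks -sum1_card natr_sum big_mkcond /=.
by apply: eq_bigr => s _; rewrite inE -natrM mulnb; case: (_ && _).
Qed.

Let subg_alpha := subg A alpha.

(** The two factors of an element of [A] lie both in [A] or both outside it; in the second case (v
    beta)(u beta) = v f(u) alpha. *)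
Lemma conn_walks_A (a : aT) :
  (conn_walks (sgval a))%:R
  = (x * x + y * zgmap fA y * zgset aC [set subg_alpha]) a.
Proof.
rewrite conn_walksE (sum_index2 index_A betaA) zgD; congr (_ + _).
  rewrite zgMV; apply: eq_bigr => u _.
  by rewrite mem_conn_A -[(sgval a * _)%g]/(sgval (a * u^-1)%g) mem_conn_A !zgsetE.
rewrite zgM_set1 [y * _]mulrC zgMV [RHS](reindex_inj (inv_inj subg_funK)).
apply: eq_bigr => u _; rewrite mem_conn_Ab zgmapE.
rewrite subg_funK !zgsetE; congr (_ * _%:R); congr nat_of_bool.
rewrite -mem_conn_Ab; congr (in_mem _ _).
(* Trading beta^-1 for alpha^-1 beta gives the cofactor the shape v beta, where membership in [Y]
   can be read. *)
have bV : (beta^-1 = alpha^-1 * beta)%g by rewrite -beta_sq expgS expg1 invMg mulgKV.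
have -> : (sgval u * beta = beta * f (sgval u))%g.
  by rewrite mul_beta ?invol_perm // -sgval_fun subgP.
have sE : (sgval (a * subg_alpha^-1 * (fA u)^-1) = sgval a * alpha^-1 * (f (sgval u))^-1)%g.
  by rewrite -sgval_fun -[in RHS](subgK _ alpha_A).
have cm : ((f (sgval u))^-1 * alpha^-1 = alpha^-1 * (f (sgval u))^-1)%g.
  by apply: (centsP abelian_A); rewrite groupV // -sgval_fun subgP.
by rewrite sE invMg {1}bV -(mulgA (sgval a) alpha^-1%g) -cm !mulgA.
Qed.

(** Exactly one factor lies in [A]: v (u beta) contributes x y, and (u beta) v = u f(v) beta
    contributes y f(x). *)
Lemma conn_walks_Ab (a : aT) :
  (conn_walks (sgval a * beta)%g)%:R = (y * (x + zgmap fA x)) a.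
Proof.
rewrite conn_walksE (sum_index2 index_A betaA) mulrDr addrC zgD; congr (_ + _).
  rewrite zgMV; apply: eq_bigr => u _; rewrite mem_conn_Ab !zgsetE.
  congr (_ * _%:R); congr nat_of_bool; rewrite -mem_conn_A; congr (in_mem _ _).
  by rewrite invMg mulgA mulgK.
rewrite [y * _]mulrC zgMV [RHS](reindex_inj (inv_inj subg_funK)).
apply: eq_bigr => u _; rewrite mem_conn_A zgmapE subg_funK !zgsetE.
congr (_ * _%:R); congr nat_of_bool; rewrite -mem_conn_Ab; congr (in_mem _ _).
rewrite -[sgval (_ * _)%g]/(sgval a * sgval (fA u)^-1)%g -!mulgA; congr (_ * _)%g.
by rewrite mul_beta ?groupV ?subgP // -invol_morphV //; [rewrite sgval_fun|apply: subg_funM].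
Qed.

Lemma dsrg_equationsP (m : nat) : (0 < m)%N ->
  is_dsrg (cayley S) #|gT| m.*2 m m.-1 m <->
  [/\ (#|X'| + #|Y'|)%N = m.*2,
      x * x + y * zgmap fA y * zgset aC [set subg_alpha] + x = m%:~R * zgset aC setT
    & y * (x + zgmap fA x + 1) = m%:~R * zgset aC setT].
Proof.
move=> m_gt0.
rewrite (cayley_dsrgP _ _ _ _ conn1) card_conn !card_subg_preim ?X_subA ?Y_sub //.
(* The three prescribed values merge into m minus the indicator of S, because 1 is not in S. The
   graph condition is then one linear equation on G, which splits over [A] and its other coset. *)
have ifE g : (if g == 1%g then m else if g \in S then m.-1 else m)
           = (m - (g \in S))%N.
  by case: eqP => [->|_]; [rewrite (negPf conn1) subn0|case: (g \in S); rewrite ?subn0 ?subn1].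
have natE (g : gT) (b : bool) :
    conn_walks g = (m - b)%N <-> (conn_walks g)%:R + b%:R = m%:R :> int.
  by case: b; lia.
split=> [[cS wE]|[cS eqA eqB]].
  have wE' g : (conn_walks g)%:R + (g \in S)%:R = m%:R :> int.
    by apply/natE; rewrite -ifE -wE.
  split=> //; apply/ffunP=> a.
    by rewrite zgD -conn_walks_A zgMz !zgsetE -mem_conn_A wE' in_setT mulr1 natz.
  rewrite mulrDr mulr1 zgD -conn_walks_Ab zgMz !zgsetE -mem_conn_Ab wE'.
  by rewrite in_setT mulr1 natz.
split=> // g; rewrite ifE; apply/natE.
have [gA|gA] := boolP (g \in A).
  rewrite -(subgK _ gA) mem_conn_A conn_walks_A -(zgsetE aC) -zgD eqA zgMz zgsetE.
  by rewrite in_setT mulr1 natz.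
have -> : g = (sgval (subg A (g * beta^-1)) * beta)%g.
  by rewrite [sgval _]subgK ?mulgKV ?(index2_mem index_A betaA).
rewrite mem_conn_Ab conn_walks_Ab -(zgsetE aC) -zgD -{2}[y]mulr1 -mulrDr eqB zgMz.
by rewrite zgsetE in_setT mulr1 natz.
Qed.

Lemma mem_invol_imset g (B : {set gT}) : (g \in f @: B) = (f g \in B).
Proof. by rewrite -{1}(invol_perm g) mem_imset //; apply: perm_inj. Qed.

(** Coefficientwise, the equation puts each element of [A] in exactly one of X, f(X) and {1}.
    Outside [A] nothing remains, since X and f(X) are contained in [A]. *)
Lemma antisymm_partitionP :
  X :&: f @: X = set0 /\ X :|: f @: X = A :\ 1%g <->
  x + zgmap fA x + 1 = zgset aC setT.
Proof.
split=> [[XI XU]|xE].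
  apply/ffunP=> u; rewrite !zgD zgmapE zg1 !zgsetE !inE sgval_fun.
  have := congr1 (fun B : {set gT} => sgval u \in B) XI.
  have := congr1 (fun B : {set gT} => sgval u \in B) XU.
  rewrite !inE mem_invol_imset subgP andbT -[1%g in RHS]/(sgval (1%g : aT)) (inj_eq val_inj).
  by case: (_ == _); case: (_ \in X); case: (_ \in X).
have pt g : g \in A -> ((g \in X) + (f g \in X) + (g == 1%g) = 1)%N.
  move=> gA; have := congr1 (fun w : zgring aC => w (subg A g)) xE.
  rewrite !zgD zgmapE zg1 !zgsetE !inE sgval_fun -(inj_eq val_inj) [sgval _]subgK //.
  by rewrite [val _]subgK // -!natrD => /eqP; rewrite eqr_nat => /eqP.
have fXA g : f g \in X -> g \in A.
  by move/(subsetP X_subA) => fgA; rewrite -(invol_perm g) Aut_closed.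
split; apply/setP=> g; rewrite !inE mem_invol_imset.
  have [gA|gA] := boolP (g \in A).
    by have := pt g gA; case: (_ \in X); case: (_ \in X); case: (_ == _).
  by apply: contraNF gA => /andP[/(subsetP X_subA)].
have [gA|gA] := boolP (g \in A).
  by have := pt g gA; case: (_ \in X); case: (_ \in X); case: (_ == _).
by rewrite andbF; apply: contraNF gA => /orP[/(subsetP X_subA)|/fXA].
Qed.

Lemma gset_mx_mul_map (F : fieldType) (B : {set gT}) : B \subset A ->
  let b := zgset aC (subg_preim B) in
  gset_mx F A B *m galg_map f (gset_mx F A B)
  = \sum_(u : aT) ((b * zgmap fA b) u)%:~R *: regular_repr F A (sgval u).
Proof.
move=> BA b; rewrite galg_map_gset_mx // gset_mx_subg // mulmx_suml.
under [RHS]eq_bigr => u _ do rewrite zgM rmorph_sum scaler_suml.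
rewrite exchange_big /=; apply: eq_bigr => h _.
rewrite mulmx_sumr (reindex_inj (inv_inj subg_funK)) [RHS](reindex_inj (mulgI h)).
apply: eq_bigr => v _; rewrite mulKg zgmapE !zgsetE !inE.
rewrite -scalemxAl -scalemxAr scalerA intrM !mulrz_nat; congr (_ *: _).
by rewrite [sgval (h * v)%g]/(sgval h * sgval v)%g repr_mxM ?subgP // sgval_fun invol_perm.
Qed.

(** Both matrix products have the integral coefficients cast into [F], and the cast is injective in
    characteristic zero. *)
Lemma gset_mx_mul_mapP (F : numFieldType) :
  gset_mx F A X *m galg_map f (gset_mx F A X)
  = gset_mx F A Y *m galg_map f (gset_mx F A Y) <->
  x * zgmap fA x = y * zgmap fA y.
Proof.
rewrite !gset_mx_mul_map ?X_subA //; split=> [|-> //].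
move/regular_coef_inj => eq_xy; apply/ffunP=> u.
by apply/eqP; rewrite -(eqr_int F) eq_xy.
Qed.

End CayleyIndexTwo.

Local Close Scope ring_scope.

Theorem theorem3 (R : realType) (n : nat) (gT : finGroupType)
    (A : {group gT}) (alpha beta : gT) (f : {perm gT}) (X Y : {set gT})
    (n_ge3 : 3 <= n) (n_odd : odd n)
    (order_G : #|[set: gT]| = 2 * n)
    (nonabelian_G : ~~ abelian [set: gT])
    (abelian_A : abelian A)
    (index_A : #|[set: gT] : A|%g = 2)
    (gen_G : <<A :|: [set beta]>>%g = [set: gT])
    (alpha_A : alpha \in A)
    (beta_sq : (beta ^+ 2)%g = alpha)
    (beta_conj : forall a, a \in A -> (beta * a * beta^-1)%g = f a)
    (f_aut : f \in Aut A) (f_order : #[f]%g = 2) (f_alpha : f alpha = alpha)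
    (X_sub : X \subset A :\ 1%g) (Y_sub : Y \subset A) :
  is_dsrg (cayley (X :|: (Y :* beta)%g))
    (2 * n) (n - 1) ((n - 1) %/ 2) ((n - 3) %/ 2) ((n - 1) %/ 2)
  <->
  [/\ #|X| = (n - 1) %/ 2 /\ #|Y| = (n - 1) %/ 2,
      X :&: f @: X = set0 /\ X :|: f @: X = A :\ 1%g,
      alpha = 1%g
    & (gset_mx R[i] A X *m galg_map f (gset_mx R[i] A X)
       = gset_mx R[i] A Y *m galg_map f (gset_mx R[i] A Y))%R].
Proof.
(* With n = 2m + 1 the degree and the other parameters become 2m, m, m - 1 and m. *)
pose m := n./2; have nE : n = m.*2.+1 by rewrite -[LHS]odd_double_half n_odd.
have m_gt0 : (0 < m)%N by rewrite half_gt0 ltnW.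
(* Otherwise [A] would contain the generators of G and have index 1. *)
have betaA : beta \notin A.
  apply/negP=> bA; have sGA : [set: gT] \subset A.
    by rewrite -gen_G gen_subG subUset subxx sub1set.
  by have := indexg_gt1 [set: gT]%G A; rewrite index_A sGA.
have cardA : #|subg_of A| = m.*2.+1.
  rewrite card_sub -nE; apply/eqP; rewrite -(eqn_pmul2r (isT : 0 < 2)%N).
  by rewrite -{1}index_A Lagrange ?subsetT // order_G mulnC.
have -> : ((n - 1) %/ 2 = m)%N by rewrite nE subn1 divn2 doubleK.
have -> : ((n - 3) %/ 2 = m.-1)%N by rewrite nE divn2; lia.
have -> : (n - 1 = m.*2)%N by rewrite nE subn1.
have dsrgP := dsrg_equationsP abelian_A index_A betaA alpha_A beta_sq beta_conj
  f_aut f_order X_sub Y_sub m_gt0.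
have partP := antisymm_partitionP abelian_A f_aut f_order X_sub.
have mulP := gset_mx_mul_mapP abelian_A f_aut f_order X_sub Y_sub R[i].
rewrite -order_G cardsT; apply: (iff_trans dsrgP).
have fM := subg_funM f_aut; have fK := subg_funK f_aut f_order.
have sX := subset_trans X_sub (subD1set _ _).
have f1 : subg_fun f (subg A alpha) = subg A alpha.
  by apply: val_inj; rewrite /= sgval_fun // [sgval _]subgK.
have X1 : 1%g \notin subg_preim A X.
  by rewrite inE; apply/negP => /(subsetP X_sub); rewrite !inE eqxx.
split=> [[cXY eqA eqB]|[[cX cY] /partP xE a1 /mulP xy]].
  have cX := zg_equations_cardX fK cardA cXY eqB.
  have cY := zg_equations_cardY fK cardA cXY eqB.
  have a1 := zg_equations_alpha1 fM fK cardA f1 cXY eqB.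
  have [xE xy] := zg_equations_nec fM fK cardA f1 X1 cXY eqA eqB.
  split; [by rewrite !card_subg_preim in cX cY|exact/partP| |exact/mulP].
  by rewrite -(subgK _ alpha_A) a1.
apply: zg_equations_suff => //; split=> //; first by rewrite !card_subg_preim.
by rewrite a1; apply: val_inj; rewrite /= [sgval _]subgK.
Qed.
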